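(* The representation $\pi_{F_B}$ of $\mathcal{O}_2$ on $\ell^2(\mathcal{I})$ extends to a representation $\tilde\pi_{F_B}$ of $\mathcal{O}_2\rtimes_\theta\mathbb{Z}_2$ on $\ell^2(\mathcal{I})$.
   Context: $\mathcal{O}_2$ is the universal $C^*$-algebra generated by $S_1,S_2$ with $S_i^*S_j=\delta_{ij}1$ and $S_1S_1^*+S_2S_2^*=1$. The flip-flop automorphism $\theta$ of $\mathcal{O}_2$ is given by $\theta(S_1)=S_2$, $\theta(S_2)=S_1$; being an involution, it defines an action of $\mathbb{Z}_2=\mathbb{Z}/2\mathbb{Z}$, and $\mathcal{O}_2\rtimes_\theta\mathbb{Z}_2$ is the associated crossed product (containing $\mathcal{O}_2$). Let $\mathcal{I}=[0,1]\setminus\mathbb{Q}$ and let $\ell^2(\mathcal{I})$ have orthonormal basis $\{e_x:x\in\mathcal{I}\}$. $F_B$ is the slow continued fraction algorithm with partition $[0,\frac12],[\frac12,1]$ and inverse branches $x\mapsto\frac{x}{1+x}$ and $x\mapsto\frac1{2-x}$; the associated representation $\pi_{F_B}:\mathcal{O}_2\to B(\ell^2(\mathcal{I}))$ is given by $\pi_{F_B}(S_1)e_x=e_{x/(1+x)}$, $\pi_{F_B}(S_2)e_x=e_{1/(2-x)}$. Representations are unital. *)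

(* Defs.v *)
(* The complex numbers are [R[i]] for an arbitrary [R : realType]. Inner
   products are linear in the first variable. *)
From HB Require Import structures.
From mathcomp Require Import all_boot all_order all_algebra all_fingroup.
From mathcomp Require Import sesquilinear complex.
From mathcomp Require Import all_classical all_reals.
From mathcomp Require Import ereal topology normedtype sequences esum.
From mathcomp Require Import lra ring.
Set Implicit Arguments.
Unset Strict Implicit.
Unset Printing Implicit Defensive.
Import Order.TTheory GRing.Theory Num.Theory.
Import numFieldNormedType.Exports.
Local Open Scope classical_set_scope.
Local Open Scope complex_scope.
Local Open Scope ring_scope.

(* Unital C*-algebras; as [algType] rings are nontrivial, 1 <> 0. The norm is
   an explicit real-valued field [cnorm]: HB accepts no join of rings with
   normed modules besides the number structures themselves. *)
HB.mixin Record Algebra_isCStar (R : realType) A & GRing.Algebra R[i] A := {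
  star : A -> A ;
  starK : involutive star ;
  starD : forall a b, star (a + b) = star a + star b ;
  starZ : forall (k : R[i]) a, star (k *: a) = Num.conj k *: star a ;
  starM : forall a b, star (a * b) = star b * star a ;
  cnorm : A -> R ;
  cnorm0_eq0 : forall a, cnorm a = 0 -> a = 0 ;
  ler_cnormD : forall a b, cnorm (a + b) <= cnorm a + cnorm b ;
  cnormZ : forall (k : R[i]) a, cnorm (k *: a) = Normc.normc k * cnorm a ;
  ler_cnormM : forall a b, cnorm (a * b) <= cnorm a * cnorm b ;
  cnorm_starM : forall a, cnorm (star a * a) = cnorm a ^+ 2 ;
  cnorm_complete : forall u : nat -> A,
    (forall e : R, 0 < e -> exists N, forall m n,
       (N <= m)%N -> (N <= n)%N -> cnorm (u m - u n) < e) ->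
    exists l, cnorm (u n - l) @[n --> \oo] --> (0 : R)
}.

#[short(type="cstarType")]
HB.structure Definition CStarAlgebra (R : realType) :=
  {A of GRing.Algebra R[i] A & Algebra_isCStar R A}.

HB.mixin Record CompleteNormedModule_isHilbert (R : realType) H
    & CompleteNormedModule R[i] H := {
  inner : {dot H for @Num.conj R[i]} ;
  innerE : forall u : H, inner u u = `|u| ^+ 2
}.
#[short(type="hilbertType")]
HB.structure Definition Hilbert (R : realType) :=
  {H of CompleteNormedModule R[i] H & CompleteNormedModule_isHilbert R H}.

Section Summation.
Variables (R : realType) (T : choiceType).
Implicit Types f g : T -> R.

Local Notation S f := (\esum_(x in [set: T]) (f x)%:E)%E.
Local Notation fin f := (S f < +oo)%E.

(* Unordered sum of an absolutely summable family. *)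
Definition real_sum f : R :=
  fine (S (fun x => Num.max (f x) 0)) - fine (S (fun x => Num.max (- f x) 0)).

Definition complex_sum (f : T -> R[i]) : R[i] :=
  real_sum (fun x => complex.Re (f x)) +i* real_sum (fun x => complex.Im (f x)).

Let S_ge0 f : (forall x, 0 <= f x) -> (0 <= S f)%E.
Proof. by move=> f0; apply: esum_ge0 => x _; rewrite lee_fin. Qed.

Let S_fin f : (forall x, 0 <= f x) -> fin f -> S f \is a fin_num.
Proof. by move=> /S_ge0 f0 ff; rewrite ge0_fin_numE. Qed.

Let SD f g : (forall x, 0 <= f x) -> (forall x, 0 <= g x) ->
  S (fun x => f x + g x) = (S f + S g)%E.
Proof.
move=> f0 g0; rewrite -esumD => [|x _|x _]; rewrite ?lee_fin//.
Qed.

Let S_le f g : (forall x, f x <= g x) -> (S f <= S g)%E.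
Proof. by move=> fg; apply: le_esum => x _; rewrite lee_fin. Qed.

Let SZ_le f (k : R) : 0 < k -> (S (fun x => (k * f x)%R) <= k%:E * S f)%E.
Proof.
move=> k0; apply: ge_ereal_sup => _ [X [finX _] <-].
rewrite fsbig_finite//= sumEFin -mulr_sumr EFinM lee_pmul2l//.
apply: ereal_sup_ubound; exists X; first by split.
by rewrite fsbig_finite//= sumEFin.
Qed.

Let SZ f (k : R) : 0 <= k -> (S (fun x => (k * f x)%R) = k%:E * S f)%E.
Proof.
rewrite le_eqVlt => /predU1P[<-|k0].
  by rewrite mul0e esum1// => x _; rewrite mul0r.
apply/eqP; rewrite eq_le SZ_le//=.
rewrite -lee_pdivlMl//.
rewrite [in leLHS](_ : f = fun x => k^-1 * (k * f x)); last first.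
  by apply/funext => x; rewrite mulKf// gt_eqF.
by rewrite SZ_le// invr_gt0.
Qed.

Let finD f g : (forall x, 0 <= f x) -> (forall x, 0 <= g x) ->
  fin f -> fin g -> fin (fun x => f x + g x).
Proof. by move=> f0 g0 ff fg; rewrite SD// lte_add_pinfty. Qed.

Let finZ f (k : R) : 0 <= k -> (forall x, 0 <= f x) -> fin f ->
  fin (fun x => k * f x).
Proof.
by move=> k0 f0 ff; rewrite SZ// -(fineK (S_fin f0 ff)) -EFinM ltry.
Qed.

Let fin_le f g : (forall x, f x <= g x) -> fin g -> fin f.
Proof. by move=> fg ff; exact: (le_lt_trans (S_le fg) ff). Qed.

Let real_sumB f g : (forall x, 0 <= f x) -> (forall x, 0 <= g x) ->
  fin f -> fin g -> real_sum (fun x => f x - g x) = fine (S f) - fine (S g).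
Proof.
move=> f0 g0 ff fg; rewrite /real_sum.
set p := fun x => Num.max (f x - g x) 0.
set n := fun x => Num.max (- (f x - g x)) 0.
have p0 x : 0 <= p x by rewrite /p le_max lexx orbT.
have n0 x : 0 <= n x by rewrite /n le_max lexx orbT.
have fp : fin p.
  by apply: (@fin_le p f) => // x; rewrite /p ge_max f0 andbT gerBl.
have fn : fin n.
  by apply: (@fin_le n g) => // x; rewrite /n ge_max g0 andbT opprB gerBl.
have : (S p + S g = S f + S n)%E.
  rewrite -!SD//; apply: eq_esum => x _; congr EFin; rewrite /p /n.
  by case: (lerP (f x - g x) 0) => h; case: (lerP (- (f x - g x)) 0) => h'; lra.
move=> /(congr1 fine); rewrite !fineD ?S_fin// => h; lra.
Qed.

Let pos f x := Num.max (f x) 0.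
Let neg f x := Num.max (- f x) 0.
Let pos0 f x : 0 <= pos f x. Proof. by rewrite /pos le_max lexx orbT. Qed.
Let neg0 f x : 0 <= neg f x. Proof. by rewrite /neg le_max lexx orbT. Qed.
Let posBneg f x : f x = pos f x - neg f x.
Proof. by rewrite /pos /neg; case: lerP => h; case: lerP => h'; lra. Qed.
Let fin_pos f : fin (fun x => `|f x|) -> fin (pos f).
Proof.
move=> ff; apply: (@fin_le _ (fun x => `|f x|)) => // x.
by rewrite /pos ge_max ler_norm normr_ge0. Qed.
Let fin_neg f : fin (fun x => `|f x|) -> fin (neg f).
Proof.
move=> ff; apply: (@fin_le _ (fun x => `|f x|)) => // x.
by rewrite /neg ge_max -normrN ler_norm normr_ge0.
Qed.

Let real_sumD f g : fin (fun x => `|f x|) -> fin (fun x => `|g x|) ->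
  real_sum (fun x => f x + g x) = real_sum f + real_sum g.
Proof.
move=> ff fg.
have -> : (fun x => f x + g x) =
    (fun x => (pos f x + pos g x) - (neg f x + neg g x)).
  by apply/funext => x; rewrite {1}(posBneg f) {1}(posBneg g); ring.
have [pf nf pg ng] := And4 (fin_pos ff) (fin_neg ff) (fin_pos fg) (fin_neg fg).
rewrite real_sumB; [|by move=> x; rewrite addr_ge0..|exact: finD|exact: finD].
rewrite !SD// !fineD ?S_fin// /real_sum -/(pos _) -/(neg _) -/(pos _) -/(neg _).
by rewrite /pos /neg; ring.
Qed.

Let real_sumZ f (k : R) : fin (fun x => `|f x|) ->
  real_sum (fun x => k * f x) = k * real_sum f.
Proof.
move=> ff; have [pf nf] := (fin_pos ff, fin_neg ff).
have [k0|/ltW k0] := leP 0 k.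
  have -> : (fun x => k * f x) = (fun x => k * pos f x - k * neg f x).
    by apply/funext => x; rewrite {1}(posBneg f); ring.
  rewrite real_sumB; [|by move=> x; rewrite mulr_ge0..|exact: finZ|exact: finZ].
  by rewrite !SZ// !fineM ?S_fin// -mulrBr.
have k0' : 0 <= - k by lra.
have -> : (fun x => k * f x) = (fun x => (- k) * neg f x - (- k) * pos f x).
  by apply/funext => x; rewrite {1}(posBneg f); ring.
rewrite real_sumB; [|by move=> x; rewrite mulr_ge0..|exact: finZ|exact: finZ].
by rewrite !SZ// !fineM ?S_fin// /real_sum -/(pos f) -/(neg f) /=; ring.
Qed.

Let real_sum_pos f : (forall x, 0 <= f x) -> real_sum f = fine (S f).
Proof.
move=> f0; rewrite /real_sum [X in _ - fine X]esum1 ?subr0.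
  by congr fine; apply: eq_esum => x _; congr EFin; apply/max_idPl.
by move=> x _; congr EFin; apply/max_idPr; rewrite oppr_le0.
Qed.

Local Notation abs_fin f := (fin (fun x => Normc.normc (f x))).

Let le_Re_normc (z : R[i]) : `|complex.Re z| <= Normc.normc z.
Proof. by rewrite -lecR; exact: normc_ge_Re. Qed.

Let le_Im_normc (z : R[i]) : `|complex.Im z| <= Normc.normc z.
Proof.
case: z => a b /=; rewrite -sqrtr_sqr ler_sqrt ?addr_ge0 ?sqr_ge0//.
by rewrite lerDr sqr_ge0.
Qed.

Let fin_Re (f : T -> R[i]) : abs_fin f -> fin (fun x => `|complex.Re (f x)|).
Proof. exact: fin_le. Qed.
Let fin_Im (f : T -> R[i]) : abs_fin f -> fin (fun x => `|complex.Im (f x)|).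
Proof. exact: fin_le. Qed.

Lemma complex_sumD (f g : T -> R[i]) : abs_fin f -> abs_fin g ->
  complex_sum (fun x => f x + g x) = complex_sum f + complex_sum g.
Proof.
move=> ff fg; rewrite /complex_sum.
under eq_fun do rewrite raddfD/=.
under [X in _ +i* real_sum X]eq_fun do rewrite raddfD/=.
by rewrite !real_sumD//; [exact: fin_Im..|exact: fin_Re|exact: fin_Re].
Qed.

Let normcMn (z w : R[i]) : Normc.normc (z * w) = Normc.normc z * Normc.normc w.
Proof. exact: Normc.normcM. Qed.

Let abs_ge0 (z : R[i]) : 0 <= Normc.normc z.
Proof. by case: z => a b; rewrite sqrtr_ge0. Qed.

Lemma complex_sumZ (k : R[i]) (f : T -> R[i]) : abs_fin f ->
  complex_sum (fun x => k * f x) = k * complex_sum f.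
Proof.
move=> ff; rewrite /complex_sum; case: k => a b.
have fRe := fin_Re ff; have fIm := fin_Im ff.
have finZn g c : fin (fun x => `|g x|) -> fin (fun x => `|c * g x|).
  move=> fg; under eq_esum do rewrite normrM.
  by apply: finZ.
have -> : (fun x => complex.Re ((a +i* b) * f x)) =
    (fun x => a * complex.Re (f x) + (- b) * complex.Im (f x)).
  by apply/funext => x; case: (f x) => u v /=; ring.
have -> : (fun x => complex.Im ((a +i* b) * f x)) =
    (fun x => a * complex.Im (f x) + b * complex.Re (f x)).
  by apply/funext => x; case: (f x) => u v /=; ring.
rewrite !real_sumD ?real_sumZ//; try exact: finZn.
apply/eqP; rewrite eq_complex /=; apply/andP; split; apply/eqP; ring.
Qed.

Lemma complex_sum_conj (f : T -> R[i]) :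
  complex_sum (fun x => Num.conj (f x)) = Num.conj (complex_sum f).
Proof.
apply/eqP; rewrite eq_complex /complex_sum; apply/andP; split; apply/eqP => /=.
  by congr real_sum; apply/funext => x; case: (f x).
rewrite /real_sum opprB; congr (fine _ - fine _); apply: eq_esum => x _;
  by case: (f x) => a b /=; rewrite ?opprK.
Qed.

Lemma complex_sum_real (f : T -> R) : (forall x, 0 <= f x) ->
  complex_sum (fun x => (f x)%:C) = (fine (S f))%:C.
Proof.
move=> f0; apply/eqP; rewrite eq_complex /= real_sum_pos// eqxx/=.
rewrite /real_sum [X in fine X]esum1 ?[X in _ - fine X]esum1 ?subrr//.
  by move=> x _; rewrite /= oppr0 maxxx.
by move=> x _; rewrite /= maxxx.
Qed.

Definition square_summable (f : T -> R[i]) :=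
  fin (fun x => Normc.normc (f x) ^+ 2).

Lemma square_summableM (f g : T -> R[i]) :
  square_summable f -> square_summable g ->
  abs_fin (fun x => f x * Num.conj (g x)).
Proof.
move=> ff fg; rewrite /square_summable in ff fg.
apply: (fin_le _ (finD _ _ ff fg)) => x; rewrite ?sqr_ge0//.
rewrite normcMn (_ : Normc.normc (Num.conj (g x)) = Normc.normc (g x)).
  have := sqr_ge0 (Normc.normc (f x) - Normc.normc (g x)).
  have := abs_ge0 (f x); have := abs_ge0 (g x); nra.
by case: (g x) => a b /=; rewrite sqrrN.
Qed.

Lemma square_summableD (f g : T -> R[i]) :
  square_summable f -> square_summable g -> square_summable (f \+ g).
Proof.
move=> ff fg; rewrite /square_summable in ff fg *.
apply: (fin_le _ (finZ (ler0n _ 2) _ (finD _ _ ff fg))) => x;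
  rewrite ?addr_ge0 ?sqr_ge0//=.
have h : Normc.normc (f x + g x) <= Normc.normc (f x) + Normc.normc (g x).
  exact: le_normcD.
have := sqr_ge0 (Normc.normc (f x) - Normc.normc (g x)).
have := abs_ge0 (f x); have := abs_ge0 (g x); have := abs_ge0 (f x + g x); nra.
Qed.

Lemma square_summableZ k (f : T -> R[i]) :
  square_summable f -> square_summable (k \*: f).
Proof.
move=> ff; rewrite /square_summable in ff *.
have := finZ (sqr_ge0 (Normc.normc k)) _ ff; rewrite /mkset.
move=> /(_ (fun=> sqr_ge0 _)).
by congr (_ < _)%E; apply: eq_esum => x _; rewrite /= normcMn exprMn.
Qed.

End Summation.

Section SquareSummable.
Variables (R : realType) (T : choiceType).

Definition l2_pred : {pred T -> R[i]} := [pred f | square_summable f].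

Lemma l2_submod_closed : submod_closed l2_pred.
Proof.
split=> [|k f g]; rewrite ?inE.
  rewrite /square_summable esum1 ?ltry// => x _.
  by have -> : (0 : T -> R[i]) x = 0 by []; rewrite Normc.normc0 expr0n.
move=> ff fg; apply: square_summableD => //; exact: square_summableZ.
Qed.

HB.instance Definition _ := GRing.isSubmodClosed.Build R[i] (T -> R[i]) l2_pred
  l2_submod_closed.

Record l2 := L2 { l2_fun :> T -> R[i] ; l2_funP : l2_fun \in l2_pred }.
HB.instance Definition _ := [isSub for l2_fun].
HB.instance Definition _ := [Choice of l2 by <:].
HB.instance Definition _ := [SubChoice_isSubLmodule of l2 by <:].

Implicit Types f g h : l2.
Local Notation S f := (\esum_(x in [set: T]) (f x)%:E)%E.

Definition l2_inner f g : R[i] := complex_sum (fun x => f x * Num.conj (g x)).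

Lemma l2_ss f : square_summable f. Proof. exact: (l2_funP f). Qed.

Lemma l2_innerDl f g h : l2_inner (f + g) h = l2_inner f h + l2_inner g h.
Proof.
rewrite /l2_inner -complex_sumD; try exact: square_summableM (l2_ss _) (l2_ss _).
by congr complex_sum; apply/funext => x; rewrite mulrDl.
Qed.

Lemma l2_innerZl k f g : l2_inner (k *: f) g = k * l2_inner f g.
Proof.
rewrite /l2_inner -complex_sumZ; last exact: square_summableM (l2_ss _) (l2_ss _).
by congr complex_sum; apply/funext => x; rewrite mulrA.
Qed.

Lemma l2_innerC f g : l2_inner f g = Num.conj (l2_inner g f).
Proof.
rewrite /l2_inner -complex_sum_conj; congr complex_sum; apply/funext => x.
by rewrite rmorphM/= conjCK mulrC.
Qed.

Definition l2_norm f : R := Num.sqrt (fine (S (fun x => Normc.normc (f x) ^+ 2))).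

Lemma normc_sqr (z : R[i]) : z * Num.conj z = (Normc.normc z ^+ 2)%:C.
Proof. by rewrite -normCK rmorphXn. Qed.

Lemma l2_inner_norm f : l2_inner f f = (l2_norm f ^+ 2)%:C.
Proof.
rewrite sqr_sqrtr; last first.
  by apply: fine_ge0; apply: esum_ge0 => x _; rewrite lee_fin sqr_ge0.
rewrite -complex_sum_real; last by move=> x; rewrite sqr_ge0.
by congr complex_sum; apply/funext => x; rewrite normc_sqr.
Qed.

Lemma l2_eval f x : Normc.normc (f x) <= l2_norm f.
Proof.
rewrite -(@ler_pXn2r _ 2)// ?nnegrE ?sqrtr_ge0//; last by case: (f x) => *; rewrite sqrtr_ge0.
have S0 : (0 <= S (fun x => Normc.normc (f x) ^+ 2))%E.
  by apply: esum_ge0 => y _; rewrite lee_fin sqr_ge0.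
rewrite sqr_sqrtr ?fine_ge0// -lee_fin fineK ?ge0_fin_numE//; last exact: l2_ss.
apply: esum_ge; exists [set x]; last by rewrite fsbig_set1.
by split => //; exact: finite_set1.
Qed.

Lemma l2_norm0_eq0 f : l2_norm f = 0 -> f = 0.
Proof.
move=> f0; apply: val_inj; apply/funext => x /=.
apply: Normc.eq0_normc; apply/eqP; rewrite eq_le -{1}f0 l2_eval/=.
by case: (f x) => *; rewrite sqrtr_ge0.
Qed.

Lemma l2_inner_zmodr f : zmod_morphism (l2_inner f).
Proof.
move=> u v; rewrite l2_innerC -scaleN1r l2_innerDl l2_innerZl rmorphD rmorphM/=.
by rewrite -!l2_innerC rmorphN1 mulN1r.
Qed.

Lemma l2_innerDr f g h : l2_inner h (f + g) = l2_inner h f + l2_inner h g.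
Proof.
by rewrite l2_innerC l2_innerDl rmorphD /= -(l2_innerC h f) -(l2_innerC h g).
Qed.

Lemma l2_inner_zmodl g : zmod_morphism (l2_inner^~ g).
Proof. by move=> u v; rewrite -scaleN1r l2_innerDl l2_innerZl mulN1r. Qed.

Lemma l2_inner_scaler f : scalable_for (Num.conj \; *%R) (l2_inner f).
Proof.
by move=> k u; rewrite l2_innerC l2_innerZl rmorphM/= -l2_innerC.
Qed.

HB.instance Definition _ := @isBilinear.Build R[i] l2 l2 R[i] *%R
  (Num.conj \; *%R) l2_inner l2_inner_zmodl l2_inner_zmodr
  (fun g k f => l2_innerZl k f g) l2_inner_scaler.

Lemma l2_inner_hermitian f g : l2_inner f g = (-1) ^+ false * Num.conj (l2_inner g f).
Proof. by rewrite expr0 mul1r -l2_innerC. Qed.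

HB.instance Definition _ := isHermitianSesquilinear.Build R[i] l2 false Num.conj
  l2_inner l2_inner_hermitian.

Lemma l2_inner_gt0 f : f != 0 -> 0 < l2_inner f f.
Proof.
move=> f0; rewrite l2_inner_norm ltcR exprn_gt0// lt_neqAle sqrtr_ge0 andbT.
by apply: contra f0 => /eqP/esym/l2_norm0_eq0 ->.
Qed.

HB.instance Definition _ := isDotProduct.Build R[i] l2 l2_inner l2_inner_gt0.

Lemma l2_norm_ge0 f : 0 <= l2_norm f. Proof. exact: sqrtr_ge0. Qed.

Lemma l2_norm_sqr f : l2_norm f ^+ 2 = complex.Re (l2_inner f f).
Proof. by rewrite l2_inner_norm. Qed.

Lemma l2_normZ (k : R[i]) f : l2_norm (k *: f) = Normc.normc k * l2_norm f.
Proof.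
have k0 : 0 <= Normc.normc k by case: k => *; rewrite sqrtr_ge0.
apply/eqP; rewrite -(@eqrXn2 _ 2)// ?mulr_ge0 ?l2_norm_ge0//.
rewrite exprMn l2_norm_sqr l2_innerZl l2_innerC l2_innerZl rmorphM/= -l2_innerC.
by rewrite mulrA normc_sqr l2_inner_norm -rmorphM/=.
Qed.

Lemma l2_normD_sqr f g : l2_norm (f + g) ^+ 2 =
  l2_norm f ^+ 2 + l2_norm g ^+ 2 + 2 * complex.Re (l2_inner f g).
Proof.
rewrite !l2_norm_sqr l2_innerDl !l2_innerDr (l2_innerC g f).
by case: (l2_inner f f) (l2_inner g g) (l2_inner f g) => ? ? [? ?] [? ?] /=; ring.
Qed.

Lemma l2_normD f g : l2_norm (f + g) <= l2_norm f + l2_norm g.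
Proof.
have [f0|f0] := eqVneq (l2_norm f) 0.
  by rewrite f0 (l2_norm0_eq0 f0) !add0r.
have [g0|g0] := eqVneq (l2_norm g) 0.
  by rewrite g0 (l2_norm0_eq0 g0) !addr0.
have {}f0 : 0 < l2_norm f by rewrite lt_neqAle eq_sym f0 l2_norm_ge0.
have {}g0 : 0 < l2_norm g by rewrite lt_neqAle eq_sym g0 l2_norm_ge0.
suff h : complex.Re (l2_inner f g) <= l2_norm f * l2_norm g.
  rewrite -(@ler_pXn2r _ 2)// ?nnegrE ?addr_ge0 ?l2_norm_ge0//.
  by rewrite l2_normD_sqr; nra.
have := sqr_ge0 (l2_norm ((l2_norm g)%:C *: f + (- l2_norm f)%:C *: g)).
have nrm (r : R) : Normc.normc r%:C ^+ 2 = r ^+ 2.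
  by rewrite /= expr0n/= addr0 sqr_sqrtr ?sqr_ge0.
rewrite l2_normD_sqr !l2_normZ !exprMn !nrm sqrrN.
rewrite l2_innerZl (l2_inner_scaler f _ g).
case: (l2_inner f g) => u v /=.
set a := l2_norm f in f0 *; set b := l2_norm g in g0 *.
rewrite !mul0r !subr0 oppr0 !mul0r !subr0 => h.
have : 0 <= 2 * (a * b) * (a * b - u) by apply: le_trans h _; lra.
by rewrite pmulr_rge0 ?subr_ge0// !mulr_gt0.
Qed.

Lemma l2_normCD f g : (l2_norm (f + g))%:C <= (l2_norm f)%:C + (l2_norm g)%:C.
Proof. by rewrite -rmorphD lecR l2_normD. Qed.

Lemma l2_normCZ (k : R[i]) f : (l2_norm (k *: f))%:C = `|k| * (l2_norm f)%:C.
Proof. by rewrite l2_normZ rmorphM. Qed.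

Lemma l2_normC0_eq0 f : (l2_norm f)%:C = 0 -> f = 0.
Proof. by move=> /complexI/l2_norm0_eq0. Qed.

HB.instance Definition _ := @Lmodule_isNormed.Build R[i] l2
  (fun f => (l2_norm f)%:C) l2_normCD l2_normCZ l2_normC0_eq0.

Lemma l2_normE f : `|f| = (l2_norm f)%:C. Proof. by []. Qed.

Lemma l2_normB f g : l2_norm (f - g) = l2_norm (g - f).
Proof. by apply: complexI; rewrite -!l2_normE distrC. Qed.

Lemma l2_subE f g x : (f - g) x = f x - g x. Proof. by []. Qed.

Lemma normc_sqrE (z : R[i]) :
  Normc.normc z ^+ 2 = complex.Re z ^+ 2 + complex.Im z ^+ 2.
Proof. by case: z => a b /=; rewrite sqr_sqrtr// addr_ge0// sqr_ge0. Qed.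

Lemma l2_norm_sqrE f : (l2_norm f ^+ 2)%:E = S (fun x => Normc.normc (f x) ^+ 2).
Proof.
have S0 : (0 <= S (fun x => Normc.normc (f x) ^+ 2))%E.
  by apply: esum_ge0 => y _; rewrite lee_fin sqr_ge0.
rewrite sqr_sqrtr ?fine_ge0// fineK// ge0_fin_numE//; exact: l2_ss.
Qed.

Section Completeness.
Variable F : set_system l2.
Hypotheses (FF : ProperFilter F) (cF : cauchy F).

Let Fex (e : R) : 0 < e -> exists g, F [set f | l2_norm (g - f) < e].
Proof.
move=> e0; move/cauchyP : cF => /(_ e%:C); rewrite ltcR => /(_ e0)[g Fg].
by exists g; apply: filterS Fg => f; rewrite -ball_normE /= l2_normE ltcR.
Qed.

Let cvg_coord (phi : l2 -> R) :
  (forall f g, `|phi f - phi g| <= l2_norm (f - g)) -> cvg (phi @ F).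
Proof.
move=> phiF; apply: R_complete; apply: cauchy_exP => e e0.
have [g Fg] := Fex e0; exists (phi g).
suff : F (phi @^-1` ball (phi g) e) by [].
apply: filterS Fg => f /= gf.
by rewrite -ball_normE/=; exact: le_lt_trans (phiF _ _) gf.
Qed.

Let cvg_Re x : cvg ((fun f : l2 => complex.Re (f x)) @ F).
Proof.
apply: cvg_coord => f g; apply: le_trans (l2_eval _ x).
by rewrite -lecR l2_subE -raddfB; exact: normc_ge_Re.
Qed.

Let cvg_Im x : cvg ((fun f : l2 => complex.Im (f x)) @ F).
Proof.
apply: cvg_coord => f g; apply: le_trans (l2_eval _ x).
rewrite l2_subE -raddfB /=; case: (f x - g x) => a b /=.
by rewrite -sqrtr_sqr ler_sqrt ?addr_ge0 ?sqr_ge0// lerDr sqr_ge0.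
Qed.

Let lim_fun x : R[i] := lim ((fun f : l2 => complex.Re (f x)) @ F)
  +i* lim ((fun f : l2 => complex.Im (f x)) @ F).

Let cvg_sqB (a l : R) (u : l2 -> R) :
  u @ F --> l -> (fun f => (a - u f) ^+ 2) @ F --> (a - l) ^+ 2.
Proof.
move=> ul; have h : (fun f => a - u f) @ F --> a - l.
  by apply: cvgB => //; exact: cvg_cst.
exact: (cvgM h h).
Qed.

Let cvg_psum (h : l2) (r : seq T) :
  (fun f : l2 => \sum_(x <- r) Normc.normc (h x - f x) ^+ 2) @ F -->
  \sum_(x <- r) Normc.normc (h x - lim_fun x) ^+ 2.
Proof.
elim: r => [|x r IH].
  by rewrite big_nil; under eq_fun do rewrite big_nil; exact: cvg_cst.
rewrite big_cons; under eq_fun do rewrite big_cons.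
apply: cvgD IH.
under eq_fun do rewrite normc_sqrE !raddfB/=.
rewrite normc_sqrE !raddfB/=.
have hR := @cvg_sqB (complex.Re (h x)) _ _ (@cvg_Re x).
have hI := @cvg_sqB (complex.Im (h x)) _ _ (@cvg_Im x).
have hD := cvgD hR hI.
exact: hD.
Qed.

Let dist_lim (h : l2) (c : R) : 0 <= c ->
  F [set f | l2_norm (h - f) <= c] ->
  (S (fun x => Normc.normc (h x - lim_fun x) ^+ 2) <= (c ^+ 2)%:E)%E.
Proof.
move=> c0 Fc; apply: ge_ereal_sup => _ [X [finX _] <-].
rewrite fsbig_finite//= sumEFin lee_fin.
have cv := @cvg_psum h (finmap.enum_fset (fset_set X)).
rewrite -(cvg_lim _ cv)//; apply: limr_le; first by apply/cvg_ex; eexists; exact: cv.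
apply: filterS Fc => f /= fc.
have : l2_norm (h - f) ^+ 2 <= c ^+ 2 by rewrite ler_pXn2r ?nnegrE// l2_norm_ge0.
apply: le_trans; rewrite -lee_fin l2_norm_sqrE; apply: esum_ge.
exists X; first by split.
by rewrite fsbig_finite//= sumEFin.
Qed.

Let near_lim (e : R) : 0 < e -> F [set h |
  (S (fun x => Normc.normc (h x - lim_fun x)%R ^+ 2) <= (e ^+ 2)%:E)%E].
Proof.
move=> e0; have [g Fg] := Fex (divr_gt0 e0 (ltr0n _ 2)).
apply: filterS (Fg) => h /= gh; apply: dist_lim; first exact: ltW.
apply: filterS Fg => f /= gf; apply/ltW.
have -> : h - f = (h - g) + (g - f) by rewrite addrA subrK.
rewrite l2_normB in gh; apply: le_lt_trans (l2_normD _ _) _; lra.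
Qed.

Let lim_ss : square_summable lim_fun.
Proof.
have [h /= hl] := filter_ex (near_lim ltr01).
have -> : lim_fun = h \+ (-1) \*: (fun x => h x - lim_fun x).
  by apply/funext => x /=; rewrite scaleN1r opprB addrC subrK.
apply: square_summableD; first exact: l2_ss.
by apply: square_summableZ; exact: le_lt_trans hl (ltry _).
Qed.

Lemma l2_cvg_lim : cvg F.
Proof.
have lp : lim_fun \in l2_pred by rewrite inE; exact: lim_ss.
apply/cvg_ex; exists (L2 lp); apply/cvg_ballP => e; rewrite ltcE => /andP[/eqP e1 e0].
have -> : e = (complex.Re e)%:C by case: e e1 {e0} => a b /= ->.
have := near_lim (divr_gt0 e0 (ltr0n _ 2)); apply: filterS => h /= hl.
rewrite -ball_normE /= l2_normE ltcR l2_normB.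
apply: (@le_lt_trans _ _ (complex.Re e / 2)); last by move: e0 => /=; lra.
have e2 : 0 <= complex.Re e / 2 by rewrite divr_ge0// ltW.
by rewrite -(@ler_pXn2r _ 2)// ?nnegrE ?l2_norm_ge0// -lee_fin l2_norm_sqrE.
Qed.
End Completeness.

HB.instance Definition _ := Uniform_isComplete.Build l2 l2_cvg_lim.

Lemma l2_innerE f : l2_inner f f = `|f| ^+ 2.
Proof. by rewrite l2_inner_norm rmorphXn. Qed.

HB.instance Definition _ := CompleteNormedModule_isHilbert.Build R l2 l2_innerE.
End SquareSummable.

Section Basis.
Variables (R : realType) (T : choiceType).

Lemma l2_basis_subproof (x : T) : (fun y => (y == x)%:R : R[i]) \in @l2_pred R T.
Proof.
rewrite inE /square_summable.
have -> : (fun y => (Normc.normc ((y == x)%:R : R[i]) ^+ 2)%:E) =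
    (fun y => if y \in [set x] then 1%E else 0%E).
  apply/funext => y; have [->|yx] := eqVneq y x.
    by rewrite mem_set// Normc.normc1 expr1n.
  by rewrite memNset ?Normc.normc0 ?expr0n//= => /eqP; rewrite (negPf yx).
by rewrite -esum_mkcond esum_set1// ltry.
Qed.

Definition l2_basis (x : T) : l2 R T := L2 (l2_basis_subproof x).

End Basis.

Section Operators.
Variable R : realType.

Record bounded_op (H : hilbertType R) := BoundedOp {
  op_linear :> {linear H -> H} ;
  op_continuous : continuous op_linear
}.

Definition is_adjoint (H : hilbertType R) (T T' : bounded_op H) :=
  forall u v, inner (T u) v = inner u (T' v).

Record representation (A : cstarType R) (H : hilbertType R) := Representation {
  rep_op :> A -> bounded_op H ;
  rep_linear : forall (k : R[i]) a b v,
    rep_op (k *: a + b) v = k *: rep_op a v + rep_op b v ;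
  rep_mul : forall a b v, rep_op (a * b) v = rep_op a (rep_op b v) ;
  rep_one : forall v, rep_op 1 v = v ;
  rep_star : forall a, is_adjoint (rep_op a) (rep_op (star a))
}.

Definition closed_star_subalgebra (A : cstarType R) (B : set A) : Prop :=
  [/\ B 1,
      forall (k : R[i]) a b, B a -> B b -> B (k *: a + b),
      forall a b, B a -> B b -> B (a * b),
      forall a, B a -> B (star a) &
      forall (u : nat -> A) l, (forall n, B (u n)) ->
        cnorm (u n - l) @[n --> \oo] --> (0 : R) -> B l].

Definition generates (A : cstarType R) (X : set A) :=
  forall B : set A, closed_star_subalgebra B -> X `<=` B -> B = setT.

Definition cuntz_relations (A : cstarType R) (S1 S2 : A) : Prop :=
  [/\ star S1 * S1 = 1, star S1 * S2 = 0, star S2 * S1 = 0, star S2 * S2 = 1 &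
      S1 * star S1 + S2 * star S2 = 1].

(* [T1'] and [T2'] are the adjoints of [T1] and [T2]. *)
Definition op_cuntz_relations (H : hilbertType R) (T1 T1' T2 T2' : bounded_op H)
    : Prop :=
  [/\ is_adjoint T1 T1', is_adjoint T2 T2' &
      forall v, [/\ T1' (T1 v) = v, T1' (T2 v) = 0, T2' (T1 v) = 0,
                    T2' (T2 v) = v & T1 (T1' v) + T2 (T2' v) = v]].

(* [A] is the universal C*-algebra generated by [S1], [S2] subject to the
   Cuntz relations: every realization of the relations by operators on a
   Hilbert space comes from a unique representation of [A]. *)
Record is_cuntz_algebra (A : cstarType R) (S1 S2 : A) : Prop := {
  cuntz_rel : cuntz_relations S1 S2 ;
  cuntz_gen : generates [set S1; S2] ;
  cuntz_universal : forall (H : hilbertType R) (T1 T1' T2 T2' : bounded_op H),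
    op_cuntz_relations T1 T1' T2 T2' ->
    exists pi : representation A H,
      [/\ forall v, pi S1 v = T1 v, forall v, pi S2 v = T2 v &
          forall pi' : representation A H,
            (forall v, pi' S1 v = T1 v) -> (forall v, pi' S2 v = T2 v) ->
            forall a v, pi' a v = pi a v]
}.

Record is_flip_flop (A : cstarType R) (S1 S2 : A)
    (theta : {lrmorphism A -> A}) : Prop := {
  flip_bij : bijective theta ;
  flip_star : forall a, theta (star a) = star (theta a) ;
  flip_S1 : theta S1 = S2 ;
  flip_S2 : theta S2 = S1
}.

(* The action of Z/2 defined by an involution; in the group ['Z_2] the law is
   the addition of residues 0 and 1. *)
Definition involution_action (A : Type) (theta : A -> A) (g : 'Z_2) : A -> A :=
  iter g theta.

(* Covariant representations of [(A, G, alpha)]. The last clause is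
   V_g phi(a) V_g^* = phi(alpha_g(a)), as V_g^* = V_(g^-1). *)
Record is_covariant (G : finGroupType) (A : cstarType R) (alpha : G -> A -> A)
    (H : hilbertType R) (phi : representation A H) (V : G -> bounded_op H)
    : Prop := {
  cov_one : forall v, V 1%g v = v ;
  cov_mul : forall g h v, V (g * h)%g v = V g (V h v) ;
  cov_unitary : forall g, is_adjoint (V g) (V g^-1%g) ;
  cov_conj : forall g a v, V g (phi a (V g^-1%g v)) = phi (alpha g a) v
}.

(* [C], with [iota : A -> C] and the unitaries [U g], is the crossed product
   of [A] by the action [alpha] of the finite group [G]: the C*-algebra that is
   universal for covariant representations. *)
Record is_crossed_product (G : finGroupType) (A : cstarType R)
    (alpha : G -> A -> A) (C : cstarType R) (iota : {lrmorphism A -> C})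
    (U : G -> C) : Prop := {
  cp_star : forall a, iota (star a) = star (iota a) ;
  cp_one : U 1%g = 1 ;
  cp_mul : forall g h, U (g * h)%g = U g * U h ;
  cp_unitary : forall g, star (U g) = U g^-1%g ;
  cp_conj : forall g a, U g * iota a * star (U g) = iota (alpha g a) ;
  cp_gen : generates (range iota `|` range U) ;
  cp_universal : forall (H : hilbertType R) (phi : representation A H)
      (V : G -> bounded_op H), is_covariant alpha phi V ->
    exists psi : representation C H,
      [/\ forall a v, psi (iota a) v = phi a v, forall g v, psi (U g) v = V g v &
          forall psi' : representation C H,
            (forall a v, psi' (iota a) v = phi a v) ->
            (forall g v, psi' (U g) v = V g v) ->
            forall c v, psi' c v = psi c v]
}.

End Operators.

Section SlowContinuedFractions.
Variable R : realType.

Definition unit_irrational : set R := `[0, 1] `&` irrational.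

Lemma slowL_subproof (x : unit_irrational) :
  unit_irrational (\val x / (1 + \val x)).
Proof.
case: x => x /= /set_mem[]; rewrite /= in_itv/= => /andP[x0 x1] xI.
have x1' : 0 < 1 + x by lra.
split; first by rewrite /= in_itv/= divr_ge0 ?(ltW x1')//= ler_pdivrMr// mul1r; lra.
move=> [q _ qE]; apply: xI; exists (q / (1 - q)) => //.
by rewrite fmorph_div rmorphB rmorph1/= qE; field; lra.
Qed.

Lemma slowR_subproof (x : unit_irrational) :
  unit_irrational (1 / (2 - \val x)).
Proof.
case: x => x /= /set_mem[]; rewrite /= in_itv/= => /andP[x0 x1] xI.
have x1' : 0 < 2 - x by lra.
split; first by rewrite /= in_itv/= div1r invr_ge0 (ltW x1')/= invf_le1//; lra.
move=> [q _ qE]; apply: xI; exists (2 - q^-1) => //.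
by rewrite rmorphB fmorphV rmorph_nat/= qE; field; lra.
Qed.

(* The inverse branches of F_B. *)
Definition slowL (x : unit_irrational) : unit_irrational :=
  SigSub (mem_set (slowL_subproof x)).
Definition slowR (x : unit_irrational) : unit_irrational :=
  SigSub (mem_set (slowR_subproof x)).

Definition is_pi_FB (A : cstarType R) (S1 S2 : A)
    (pi : representation A (l2 R unit_irrational)) : Prop :=
  (forall x, pi S1 (l2_basis R x) = l2_basis R (slowL x)) /\
  (forall x, pi S2 (l2_basis R x) = l2_basis R (slowR x)).

End SlowContinuedFractions.
Arguments unit_irrational R : clear implicits.

(* Main.v *)
Require Import Defs.
From HB Require Import structures.
From mathcomp Require Import all_boot all_order all_algebra all_fingroup.
From mathcomp Require Import complex all_classical all_reals.
From mathcomp Require Import topology normedtype esum lra ring.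
Set Implicit Arguments.
Unset Strict Implicit.
Unset Printing Implicit Defensive.
Import Order.TTheory GRing.Theory Num.Theory.
Local Open Scope classical_set_scope.
Local Open Scope complex_scope.
Local Open Scope ring_scope.

(** The reflection x |-> 1 - x of the irrationals of [0, 1] exchanges the two
    inverse branches of F_B: 1 - x / (1 + x) = 1 / (2 - (1 - x)). The
    self-adjoint unitary V with V e_x = e_(1 - x) therefore satisfies
    V pi(S1) V = pi(S2) and V pi(S2) V = pi(S1) on basis vectors, hence
    everywhere ([eq_op_l2_basis]). So a |-> V pi(theta(a)) V
    ([rep_conj]) is a representation that agrees with pi on S1 and S2; by the
    uniqueness part of the universal property of the Cuntz algebra
    ([cuntz_rep_unique]) it is pi. Thus V implements theta, the pair (pi, V) is
    covariant for the action of Z/2 ([involution_covariant]), and the universal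
    property of the crossed product yields the extension. *)

(** * Bounded operators *)

Lemma op_id_continuous (R : realType) (H : hilbertType R) :
  continuous (@idfun H).
Proof. by move=> v; exact: cvg_id. Qed.

Definition op_id (R : realType) (H : hilbertType R) : bounded_op H :=
  @BoundedOp R H idfun (@op_id_continuous R H).

Lemma op_comp_continuous (R : realType) (H : hilbertType R)
  (T T' : bounded_op H) : continuous (T \o T').
Proof.
by move=> v; apply: continuous_comp; exact: op_continuous.
Qed.

Definition op_comp (R : realType) (H : hilbertType R) (T T' : bounded_op H) :
  bounded_op H := @BoundedOp R H (T \o T') (@op_comp_continuous R H T T').

Lemma op_comp_adjoint (R : realType) (H : hilbertType R)
    (T T' W W' : bounded_op H) :
  is_adjoint T T' -> is_adjoint W W' ->
  is_adjoint (op_comp T W) (op_comp W' T').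
Proof. by move=> hT hW u v; rewrite /= hT hW. Qed.

Lemma isometry_continuous (R : realType) (H : hilbertType R)
  (f : {linear H -> H}) : (forall v, `|f v| = `|v|) -> continuous f.
Proof.
move=> fN v; apply/cvgrPdist_lt => e e0; near=> w.
rewrite -linearB/= fN; near: w.
exact: cvgr_dist_lt.
Unshelve. all: by end_near. Qed.

(** * Representations *)

Lemma rep0 (R : realType) (A : cstarType R) (H : hilbertType R)
    (pi : representation A H) v : pi 0 v = 0.
Proof.
have := rep_linear pi 1 0 0 v; rewrite !scale1r addr0 => /eqP.
by rewrite -subr_eq0 opprD addNKr oppr_eq0 => /eqP.
Qed.

Lemma repD (R : realType) (A : cstarType R) (H : hilbertType R)
    (pi : representation A H) a b v : pi (a + b) v = pi a v + pi b v.
Proof. by have := rep_linear pi 1 a b v; rewrite !scale1r. Qed.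

Lemma rep_cuntz_relations (R : realType) (A : cstarType R) (S1 S2 : A)
    (H : hilbertType R) (pi : representation A H) :
  cuntz_relations S1 S2 ->
  op_cuntz_relations (pi S1) (pi (star S1)) (pi S2) (pi (star S2)).
Proof.
case=> r11 r12 r21 r22 r1; split; try exact: rep_star.
by move=> v; rewrite -!rep_mul -repD r11 r12 r21 r22 r1 !rep_one !rep0.
Qed.

Lemma cuntz_rep_unique (R : realType) (A : cstarType R) (S1 S2 : A)
    (H : hilbertType R) (pi pi' : representation A H) :
  is_cuntz_algebra S1 S2 ->
  (forall v, pi S1 v = pi' S1 v) -> (forall v, pi S2 v = pi' S2 v) ->
  forall a v, pi a v = pi' a v.
Proof.
move=> hA e1 e2 a v.
have [rho [_ _ uniq]] :=
  cuntz_universal hA (rep_cuntz_relations pi' (cuntz_rel hA)).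
by rewrite (uniq pi)// (uniq pi').
Qed.

(** The representation a |-> V pi(theta(a)) V, for a self-adjoint unitary V
    and a *-endomorphism theta. *)
Lemma rep_conj (R : realType) (A : cstarType R) (H : hilbertType R)
    (pi : representation A H) (theta : {lrmorphism A -> A}) (V : bounded_op H) :
  (forall a, theta (star a) = star (theta a)) ->
  is_adjoint V V -> (forall v, V (V v) = v) ->
  exists rho : representation A H, forall a v, rho a v = V (pi (theta a) (V v)).
Proof.
move=> hstar hV VV.
have rl (k : R[i]) a b v : op_comp V (op_comp (pi (theta (k *: a + b))) V) v =
    k *: op_comp V (op_comp (pi (theta a)) V) v +
    op_comp V (op_comp (pi (theta b)) V) v.
  by rewrite /= linearP rep_linear linearP.
have rm a b v : op_comp V (op_comp (pi (theta (a * b))) V) v =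
    op_comp V (op_comp (pi (theta a)) V)
      (op_comp V (op_comp (pi (theta b)) V) v).
  by rewrite /= VV rmorphM rep_mul.
have r1 v : op_comp V (op_comp (pi (theta 1)) V) v = v.
  by rewrite /= rmorph1 rep_one VV.
have rs a : is_adjoint (op_comp V (op_comp (pi (theta a)) V))
    (op_comp V (op_comp (pi (theta (star a))) V)).
  by move=> u v; rewrite /= hV rep_star hV hstar.
by exists (Representation rl rm r1 rs).
Qed.

(** A self-adjoint unitary that implements [theta] gives a covariant
    representation of the action of Z/2 defined by [theta]. *)
Lemma involution_covariant (R : realType) (A : cstarType R)
    (H : hilbertType R) (pi : representation A H) (theta : A -> A)
    (V : bounded_op H) :
  is_adjoint V V -> (forall v, V (V v) = v) ->
  (forall a v, V (pi a (V v)) = pi (theta a) v) ->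
  @is_covariant R 'Z_2 A (involution_action theta) H pi
    (fun g : 'Z_2 => if g == 0 then op_id H else V).
Proof.
move=> hV VV hpi; split => //=.
(* The elements of 'Z_2 are the residues 0 and 1, which are their own
   inverses. *)
- by move=> [[|[|//]] ?] [[|[|//]] ?] v //=; rewrite VV.
- by move=> [[|[|//]] ?].
- by move=> [[|[|//]] ?] a v /=.
Qed.

(** * The Hilbert space of square-summable families *)

Lemma involutive_set_bij (T : Type) (s : T -> T) :
  involutive s -> set_bij [set: T] [set: T] s.
Proof. by move=> sK; rewrite setTT_bijective; exact: inv_bij. Qed.

Lemma complex_sum_reindex (R : realType) (T : choiceType) (s : T -> T)
    (f : T -> R[i]) :
  involutive s -> complex_sum (f \o s) = complex_sum f.
Proof.
move=> /involutive_set_bij sB.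
by rewrite /complex_sum /real_sum; congr (_ +i* _); congr (_ - _);
  congr fine; rewrite [RHS](@reindex_esum _ _ _ _ _ s _ sB).
Qed.

Lemma square_summable_comp (R : realType) (T : choiceType) (s : T -> T)
    (f : T -> R[i]) :
  involutive s -> square_summable f -> square_summable (f \o s).
Proof.
move=> /involutive_set_bij sB.
by rewrite /square_summable (@reindex_esum _ _ _ _ _ s _ sB).
Qed.

Lemma l2_comp_subproof (R : realType) (T : choiceType) (s : T -> T)
    (sK : involutive s) (f : l2 R T) : f \o s \in @l2_pred R T.
Proof. by rewrite inE; apply: square_summable_comp => //; exact: l2_ss. Qed.

(** Composition with an involution of the index set. *)
Definition l2_comp (R : realType) (T : choiceType) (s : T -> T)
  (sK : involutive s) (f : l2 R T) : l2 R T := L2 (l2_comp_subproof sK f).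

Lemma l2_comp_linear (R : realType) (T : choiceType) (s : T -> T)
  (sK : involutive s) : linear (@l2_comp R T s sK).
Proof. by move=> k f g; exact: val_inj. Qed.

HB.instance Definition _ (R : realType) (T : choiceType) (s : T -> T)
    (sK : involutive s) :=
  GRing.isLinear.Build R[i] (l2 R T) (l2 R T) *:%R (@l2_comp R T s sK)
    (l2_comp_linear sK).

Lemma l2_compK (R : realType) (T : choiceType) (s : T -> T)
  (sK : involutive s) : involutive (@l2_comp R T s sK).
Proof. by move=> f; apply: val_inj; apply/funext => x /=; rewrite sK. Qed.

Lemma inner_l2_comp (R : realType) (T : choiceType) (s : T -> T)
    (sK : involutive s) (f g : l2 R T) :
  inner (l2_comp sK f) g = inner f (l2_comp sK g).
Proof.
rewrite /inner/= /l2_inner -[LHS](complex_sum_reindex _ sK).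
by congr complex_sum; apply/funext => x /=; rewrite sK.
Qed.

Lemma norm_l2_comp (R : realType) (T : choiceType) (s : T -> T)
  (sK : involutive s) (f : l2 R T) : `|l2_comp sK f| = `|f|.
Proof.
apply/eqP; rewrite -(@eqrXn2 _ 2)// -!innerE.
by rewrite inner_l2_comp l2_compK.
Qed.

Lemma l2_comp_continuous (R : realType) (T : choiceType) (s : T -> T)
  (sK : involutive s) : continuous (@l2_comp R T s sK).
Proof. by apply: isometry_continuous => f; exact: norm_l2_comp. Qed.

Definition l2_comp_op (R : realType) (T : choiceType) (s : T -> T)
    (sK : involutive s) : bounded_op (l2 R T) :=
  @BoundedOp R (l2 R T) (@l2_comp R T s sK) (@l2_comp_continuous R T s sK).

Lemma l2_comp_basis (R : realType) (T : choiceType) (s : T -> T)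
    (sK : involutive s) (x : T) :
  l2_comp sK (l2_basis R x) = l2_basis R (s x).
Proof.
apply: val_inj; apply/funext => y /=.
by rewrite -[y in RHS]sK (inj_eq (inv_inj sK)).
Qed.

Lemma real_sum_supp1 (R : realType) (T : choiceType) (x : T) (f : T -> R) :
  (forall y, y != x -> f y = 0) -> real_sum f = f x.
Proof.
move=> f0; have sum1 g : (forall y, y != x -> g y = 0) -> 0 <= g x ->
    fine (\esum_(y in [set: T]) (g y)%:E)%E = g x :> R.
  move=> g0 gx; rewrite -[RHS]/(fine (g x)%:E).
  rewrite -(@esum_set1 R T x (fun y => (g y)%:E)) ?lee_fin//.
  rewrite [in RHS]esum_mkcond; congr fine; apply: eq_esum => y _.
  have [->|yx] := eqVneq y x; first by rewrite mem_set.
  by rewrite memNset ?g0//= => /eqP; rewrite (negPf yx).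
rewrite /real_sum !sum1; last 4 first.
- by move=> y /f0 ->; rewrite oppr0 maxxx.
- by rewrite le_max lexx orbT.
- by move=> y /f0 ->; rewrite maxxx.
- by rewrite le_max lexx orbT.
by case: (lerP (f x) 0) => h; case: (lerP (- f x) 0) => h'; lra.
Qed.

Lemma inner_l2_basis (R : realType) (T : choiceType) (f : l2 R T) (x : T) :
  inner f (l2_basis R x) = f x.
Proof.
have fE y : f y * Num.conj (l2_basis R x y) = f y *+ (y == x).
  by rewrite /=; case: (y == x); rewrite ?rmorph1 ?rmorph0 ?mulr1 ?mulr0.
rewrite /inner/= /l2_inner; under eq_fun do rewrite fE.
rewrite /complex_sum !(@real_sum_supp1 _ _ x) ?eqxx; first by case: (f x).
- by move=> y /negPf ->.
- by move=> y /negPf ->.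
Qed.

(** Two operators that agree on the basis are equal. Passing to the adjoints
    avoids the density of the span of the basis: T* e_y and W* e_y have the
    same coordinates, as those of T e_x and W e_x agree, and
    <T v, e_y> = <v, T* e_y> is the y-th coordinate of T v. *)
Lemma eq_op_l2_basis (R : realType) (I : choiceType)
    (T T' W W' : bounded_op (l2 R I)) :
  is_adjoint T T' -> is_adjoint W W' ->
  (forall x, T (l2_basis R x) = W (l2_basis R x)) -> forall v, T v = W v.
Proof.
move=> hT hW e v; apply: val_inj; apply/funext => y /=.
rewrite -!inner_l2_basis hT hW; congr (inner v _).
apply: val_inj; apply/funext => x /=; rewrite -!inner_l2_basis.
rewrite [LHS]l2_innerC [RHS]l2_innerC; congr Num.conj.
by have := congr1 (fun u => inner u (l2_basis R y)) (e x); rewrite /= hT hW.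
Qed.

(** * The reflection of the unit interval *)

Lemma flip_subproof (R : realType) (x : unit_irrational R) :
  unit_irrational R (1 - \val x).
Proof.
case: x => x /= /set_mem[]; rewrite /= in_itv/= => /andP[x0 x1] xI.
split; first by rewrite /= in_itv/=; lra.
move=> [q _ qE]; apply: xI; exists (1 - q) => //.
by rewrite rmorphB rmorph1/= qE; ring.
Qed.

(** The reflection x |-> 1 - x. *)
Definition flip (R : realType) (x : unit_irrational R) : unit_irrational R :=
  SigSub (mem_set (flip_subproof x)).

Lemma flipK (R : realType) : involutive (@flip R).
Proof. by move=> x; apply: val_inj => /=; rewrite subKr. Qed.

Lemma flip_slowL (R : realType) (x : unit_irrational R) :
  flip (slowL x) = slowR (flip x).
Proof.
apply: val_inj; case: x => x /= /set_mem[]; rewrite /= in_itv/= => /andP[x0 _] _.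
by field; lra.
Qed.

Lemma flip_slowR (R : realType) (x : unit_irrational R) :
  flip (slowR x) = slowL (flip x).
Proof. by rewrite -[x in LHS]flipK -flip_slowL flipK. Qed.

Theorem proposition6p5 (R : realType)
    (O2 : cstarType R) (S1 S2 : O2) (hO2 : is_cuntz_algebra S1 S2)
    (theta : {lrmorphism O2 -> O2}) (htheta : is_flip_flop S1 S2 theta)
    (O2Z2 : cstarType R) (iota : {lrmorphism O2 -> O2Z2}) (U : 'Z_2 -> O2Z2)
    (hO2Z2 : is_crossed_product (involution_action theta) iota U)
    (pi_FB : representation O2 (l2 R (unit_irrational R)))
    (hpi : is_pi_FB S1 S2 pi_FB) :
  exists pi_tilde : representation O2Z2 (l2 R (unit_irrational R)),
    forall (a : O2) (v : l2 R (unit_irrational R)),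
      pi_tilde (iota a) v = pi_FB a v.
Proof.
pose V := l2_comp_op R (@flipK R).
have VV v : V (V v) = v by exact: l2_compK.
have hV : is_adjoint V V by move=> u v; exact: inner_l2_comp.
have Vb x : V (l2_basis R x) = l2_basis R (flip x) by exact: l2_comp_basis.
have [pi1 pi2] := hpi.
have V1 v : V (pi_FB S1 v) = pi_FB S2 (V v).
  have adj1 := op_comp_adjoint hV (rep_star pi_FB S1).
  have adj2 := op_comp_adjoint (rep_star pi_FB S2) hV.
  apply: (eq_op_l2_basis adj1 adj2) => x.
  by rewrite /= pi1 !Vb pi2 flip_slowL.
have V2 v : V (pi_FB S2 v) = pi_FB S1 (V v).
  by rewrite -[v in LHS]VV -V1 VV.
have [rho rhoE] := rep_conj pi_FB (flip_star htheta) hV VV.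
have rho_pi a v : rho a v = pi_FB a v.
  apply: (cuntz_rep_unique hO2) => w; rewrite rhoE.
    by rewrite (flip_S1 htheta) V2 VV.
  by rewrite (flip_S2 htheta) V1 VV.
have conjV a v : V (pi_FB a (V v)) = pi_FB (theta a) v.
  by rewrite -rho_pi rhoE VV VV.
have [psi [psiE _ _]] :=
  cp_universal hO2Z2 (involution_covariant hV VV conjV).
by exists psi.
Qed.
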